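(* Let $\alpha,a,b,c,d,\beta$ be complex numbers with $|\alpha ab/q|<1$. Then $$\frac{(\alpha q,\alpha ab/q;q)_\infty}{(\alpha a,\alpha b;q)_\infty}\;{}_3\phi_2\left({q/a,q/b,\beta\atop c,d};q,\frac{\alpha ab}{q}\right) =\sum_{n=0}^\infty\frac{(1-\alpha q^{2n})(\alpha,q/a,q/b,q\alpha/c;q)_n(\alpha abc)^nq^{n^2-2n}}{(1-\alpha)(q,\alpha a,\alpha b,c;q)_n}\;{}_3\phi_2\left({q^{-n},\alpha q^n,d/\beta\atop d,q\alpha/c};q,\frac{q\beta}{c}\right).$$
   Context: Throughout $0<q<1$. Put $(x;q)_0=1$, $(x;q)_n=\prod_{k=0}^{n-1}(1-xq^k)$, $(x;q)_\infty=\prod_{k\ge0}(1-xq^k)$, and $(x_1,\dots,x_r;q)_n=(x_1;q)_n\cdots(x_r;q)_n$ for $n$ a nonnegative integer or $\infty$. The basic hypergeometric series is $${}_3\phi_2\left({a_1,a_2,a_3\atop b_1,b_2};q,z\right)=\sum_{k=0}^\infty\frac{(a_1,a_2,a_3;q)_k}{(q,b_1,b_2;q)_k}z^k ;$$ when some $a_i=q^{-n}$ with $n\ge 0$ an integer, it is the finite sum over $0\le k\le n$. Parameters are assumed such that no denominator vanishes: $\beta,c\ne0$ and none of $\alpha a,\alpha b,c,d,q\alpha/c$ is of the form $q^{-k}$ with $k\ge0$ an integer. The values $a=0$ or $b=0$ and $\alpha=1$ are read by continuity: $(q/a;q)_na^n=\prod_{k=1}^n(a-q^k)$, similarly for $b$,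 and $(1-\alpha q^{2n})(\alpha;q)_n/(1-\alpha)$ means $1$ for $n=0$ and $(1-\alpha q^{2n})(\alpha q;q)_{n-1}$ for $n\ge1$. *)

(* Defs.v *)
From HB Require Import structures.
From mathcomp Require Import all_boot all_order all_algebra.
From mathcomp Require Import complex ring.
From mathcomp Require Import all_classical all_reals all_analysis.
Set Implicit Arguments.
Unset Strict Implicit.
Unset Printing Implicit Defensive.
Import Order.TTheory GRing.Theory Num.Theory.
Import numFieldNormedType.Exports.
Local Open Scope classical_set_scope.
Local Open Scope ring_scope.
Local Open Scope complex_scope.

Definition qpoch (K : numFieldType) (q x : K) (n : nat) : K :=
  \prod_(k < n) (1 - x * q ^+ k).

(* (x_1, ..., x_r; q)_n *)
Definition qpochs (K : numFieldType) (q : K) (xs : seq K) (n : nat) : K :=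
  \prod_(x <- xs) qpoch q x n.

(* (q/a; q)_n a^n, in the form that also makes sense at a = 0;
   see qpoch_shiftE. *)
Definition qpoch_shift (K : numFieldType) (q a : K) (n : nat) : K :=
  \prod_(1 <= k < n.+1) (a - q ^+ k).

(* (1 - x q^(2n)) (x; q)_n / (1 - x), in the form that also makes sense at
   x = 1; see vwp_factorE. *)
Definition vwp_factor (K : numFieldType) (q x : K) (n : nat) : K :=
  if n is m.+1 then (1 - x * q ^+ (2 * n)) * qpoch q (x * q) m else 1.

Definition phi32_term (K : numFieldType) (q a1 a2 a3 b1 b2 z : K) (k : nat) : K :=
  qpochs q [:: a1; a2; a3] k / qpochs q [:: q; b1; b2] k * z ^+ k.

(* The general term of 3phi2(q/a, q/b, a3; b1, b2; q, x a b / q), in the form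
   that also makes sense at a = 0 or b = 0; see phi32_shift_termE. *)
Definition phi32_shift_term (K : numFieldType) (q a b a3 b1 b2 x : K) (k : nat)
    : K :=
  qpoch_shift q a k * qpoch_shift q b k * qpoch q a3 k
    / qpochs q [:: q; b1; b2] k * (x / q) ^+ k.

Definition not_qpole (K : numFieldType) (q x : K) : Prop :=
  forall k : nat, x != q ^- k.

(* lim is total, with an arbitrary value on divergent sequences; over R[i] with
   `|q| < 1 the sequence qpoch q x always converges. *)
Definition qpoch_inf (K : numFieldType) (q x : K) : K :=
  lim (qpoch q x n @[n --> \oo]).

Definition qpochs_inf (K : numFieldType) (q : K) (xs : seq K) : K :=
  \prod_(x <- xs) qpoch_inf q x.

Definition phi32 (K : numFieldType) (q a1 a2 a3 b1 b2 z : K) : K :=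
  lim (series (phi32_term q a1 a2 a3 b1 b2 z) @ \oo).

Definition phi32_shift (K : numFieldType) (q a b a3 b1 b2 x : K) : K :=
  lim (series (phi32_shift_term q a b a3 b1 b2 x) @ \oo).

Lemma qpoch_shiftE (K : numFieldType) (q a : K) (n : nat) :
  a != 0 -> qpoch_shift q a n = qpoch q (q / a) n * a ^+ n.
Proof.
move=> a0; rewrite /qpoch_shift /qpoch big_add1 big_mkord /=.
have -> : a ^+ n = \prod_(k < n) a by rewrite prodr_const card_ord.
rewrite -big_split /=; apply: eq_bigr => k _.
by rewrite exprS; field.
Qed.

Lemma vwp_factorE (K : numFieldType) (q x : K) (n : nat) :
  x != 1 ->
  vwp_factor q x n = (1 - x * q ^+ (2 * n)) * qpoch q x n / (1 - x).
Proof.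
move=> x1; have h : 1 - x != 0 by rewrite subr_eq0 eq_sym.
case: n => [|n]; first by rewrite muln0 expr0 mulr1 /qpoch big_ord0 mulr1 divff.
rewrite /vwp_factor /qpoch big_ord_recl expr0 mulr1 mulrA mulrAC mulfK //.
by congr (_ * _); apply: eq_bigr => k _; rewrite /= exprS mulrA.
Qed.

Lemma phi32_shift_termE (K : numFieldType) (q a b a3 b1 b2 x : K) :
  a != 0 -> b != 0 ->
  phi32_shift_term q a b a3 b1 b2 x
    = phi32_term q (q / a) (q / b) a3 b1 b2 (x * a * b / q).
Proof.
move=> a0 b0; apply/funext => k.
rewrite /phi32_shift_term /phi32_term !qpoch_shiftE //.
have -> : x * a * b / q = a * b * (x / q).
  by rewrite -[x * a * b]mulrA [x * (a * b)]mulrC mulrA.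
rewrite !exprMn;
have -> : qpochs q [:: q / a; q / b; a3] k
          = qpoch q (q / a) k * qpoch q (q / b) k * qpoch q a3 k.
  by rewrite /qpochs !big_cons big_nil mulr1 mulrA.
ring.
Qed.

Lemma phi32_shiftE (K : numFieldType) (q a b a3 b1 b2 x : K) :
  a != 0 -> b != 0 ->
  phi32_shift q a b a3 b1 b2 x
    = phi32 q (q / a) (q / b) a3 b1 b2 (x * a * b / q).
Proof. by move=> a0 b0; rewrite /phi32_shift phi32_shift_termE. Qed.

Lemma phi32_terminating (K : numFieldType) (q a2 a3 b1 b2 z : K) (n : nat) :
  q != 0 ->
  phi32 q (q ^- n) a2 a3 b1 b2 z
    = \sum_(0 <= k < n.+1) phi32_term q (q ^- n) a2 a3 b1 b2 z k.
Proof.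
move=> q0; apply: lim_near_cst => //.
exists n.+1 => // m /= nm; rewrite /series /= (big_cat_nat _ nm) //=.
rewrite [X in _ + X]big_nat_cond [X in _ + X]big1 ?addr0 // => k.
rewrite andbT => /andP[nk _].
rewrite /phi32_term /qpochs big_cons /qpoch (bigD1 (Ordinal nk)) //=.
by rewrite mulVf ?expf_neq0 // subrr !mul0r.
Qed.

(* Main.v *)
Require Import Defs.
From mathcomp Require Import all_boot all_order all_algebra.
From mathcomp Require Import complex ring lra zify.
From mathcomp Require Import all_classical all_reals all_analysis.
Import Order.TTheory GRing.Theory Num.Theory.
Import numFieldNormedType.Exports.
Local Open Scope classical_set_scope.
Local Open Scope ring_scope.
Local Open Scope complex_scope.
Set Implicit Arguments.
Unset Strict Implicit.
Unset Printing Implicit Defensive.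

(** Set A_n = (1 - alpha q^(2n)) (alpha, q/a, q/b; q)_n (-alpha a b/q)^n
    q^(n(n-1)/2) / ((1 - alpha) (q, alpha a, alpha b; q)_n).  The proof reads
    the right-hand side as the sum over n of
      A_n * 3phi2(q^-n, alpha q^n, beta; c, d; q, q),
    expands each terminating 3phi2, and sums over n first.

    - The two 3phi2 forms agree up to the factor
      (q alpha/c; q)_n / (c; q)_n * (-c)^n q^(n(n-1)/2)
      ([sum_phi32_term_transform]).  Expanding (beta; q)_k / (d; q)_k by one
      form of the q-Chu-Vandermonde sum and exchanging the two finite sums
      leaves inner sums that the other form evaluates.

    - Put n = k + m, where k is the index of the terminating 3phi2.  The
      (k, m) term is, up to a finite product depending on k alone, the k-th
      term of the 3phi2 on the left times the m-th term of the very-well-poised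
      6phi5 series with one parameter sent to infinity, taken at
      (alpha q^(2k), a q^-k, b q^-k) ([vwp_term_phi32_row]).

    - That series sums to
        G(alpha, a, b) = (alpha q, alpha a b/q; q)_oo
                           / (alpha a, alpha b; q)_oo
      ([vwp_sum]): a telescoping identity relates alpha to alpha q, with
      exactly the ratio G(alpha, a, b) / G(alpha q, a, b), and the sum tends
      to its first term 1 along alpha q^N as N grows.  The shift by k changes
      G only by a finite product, which cancels the one of the (k, m) term, so
      every row k sums to the same multiple of the k-th term on the left.

    - Choosing A > |a| and B > |b| with r = |alpha| A B / q < 1, the (k, m)
      term is O(r^(k+m)) ([cnorm_terms_le]).  Hence summation along the
      diagonals k + m = n gives the same value as summation by rows
      ([cvg_series_triangle]).

    The products (q/a; q)_n a^n stay polynomial in a throughout, so a = 0 and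
    b = 0 need no separate treatment; taking A > |a| rather than A = |a| is
    what keeps the bounds uniform there. *)

(** * Finite q-products *)

(** The homogeneous form x^n (y/x; q)_n, which still makes sense at x = 0. *)
Definition hpoch (K : numFieldType) (q x y : K) (n : nat) : K :=
  \prod_(i < n) (x - y * q ^+ i).

Section QAlgebra.
Variables (K : numFieldType) (q : K).
Implicit Types x y z a b c d : K.
Implicit Types m n k : nat.

Lemma qpoch0 x : qpoch q x 0 = 1.
Proof. by rewrite /qpoch big_ord0. Qed.

Lemma qpochS x n : qpoch q x n.+1 = qpoch q x n * (1 - x * q ^+ n).
Proof. by rewrite /qpoch big_ord_recr. Qed.

Lemma qpochSl x n : qpoch q x n.+1 = (1 - x) * qpoch q (x * q) n.
Proof.
rewrite /qpoch big_ord_recl expr0 mulr1; congr (_ * _).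
by apply: eq_bigr => i _; rewrite /= exprS mulrA.
Qed.

Lemma qpochD x m n : qpoch q x (m + n) = qpoch q x m * qpoch q (x * q ^+ m) n.
Proof.
elim: n => [|n IH]; first by rewrite addn0 qpoch0 mulr1.
by rewrite addnS !qpochS IH exprD !mulrA.
Qed.

Lemma hpoch0 x y : hpoch q x y 0 = 1.
Proof. by rewrite /hpoch big_ord0. Qed.

Lemma hpochS x y n : hpoch q x y n.+1 = hpoch q x y n * (x - y * q ^+ n).
Proof. by rewrite /hpoch big_ord_recr. Qed.

Lemma hpochM z x y n : hpoch q (z * x) (z * y) n = z ^+ n * hpoch q x y n.
Proof.
elim: n => [|n IH]; first by rewrite !hpoch0 mulr1.
by rewrite !hpochS IH exprSr; ring.
Qed.

Lemma hpoch1 x n : hpoch q 1 x n = qpoch q x n.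
Proof. by []. Qed.

Lemma hpochSl x y n : hpoch q x y n.+1 = (x - y) * hpoch q x (y * q) n.
Proof.
rewrite /hpoch big_ord_recl expr0 mulr1; congr (_ * _).
by apply: eq_bigr => i _; rewrite /= exprS mulrA.
Qed.

Lemma qpoch_shift_hpoch a n : qpoch_shift q a n = hpoch q a q n.
Proof.
rewrite /qpoch_shift /hpoch big_add1 big_mkord /=.
by apply: eq_bigr => i _; rewrite exprS.
Qed.

Lemma qpoch_neq0 x n : not_qpole q x -> qpoch q x n != 0.
Proof.
move=> xP; apply/prodf_neq0 => k _; rewrite subr_eq0 eq_sym.
apply/negP => /eqP xq; have qk0 : q ^+ k != 0.
  by apply/negP => /eqP qk; move: xq; rewrite qk mulr0 => /eqP; rewrite eq_sym oner_eq0.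
by have := xP k; rewrite -[x](mulfK qk0) xq mul1r eqxx.
Qed.

Hypothesis q_neq0 : q != 0.

Lemma hpoch_qpoch x y n : x != 0 -> hpoch q x y n = x ^+ n * qpoch q (y / x) n.
Proof. by move=> x0; rewrite -hpoch1 -hpochM mulr1 mulrC divfK. Qed.

Lemma not_qpoleM x k : not_qpole q x -> not_qpole q (x * q ^+ k).
Proof.
move=> xP j; apply/negP => /eqP e; have := xP (j + k)%N.
have qk : q ^+ k != 0 by rewrite expf_neq0.
by rewrite exprD invfM -e mulfK // eqxx.
Qed.

(** Reversal of the order of the factors. *)
Lemma hpoch_rev x c m :
  c != 0 ->
  hpoch q (x * q ^+ m) c m = (- c) ^+ m * q ^+ 'C(m, 2) * qpoch q (q * x / c) m.
Proof.
move=> c0; elim: m => [|m IH]; first by rewrite hpoch0 qpoch0 !mulr1.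
rewrite hpochSl exprSr mulrA [_ * q]mulrC [c * q]mulrC hpochM IH.
rewrite qpochS binS bin1 exprD exprSr.
by field.
Qed.

(** Up to sign and a power of q, both sides say that (q^-n; q)_j is
    (q; q)_n / (q; q)_(n-j); multiplying out q^(n j) avoids negative powers. *)
Lemma hpoch_qpow j i :
  hpoch q (q ^+ (j + i)) 1 j * qpoch q q i
    = (- 1) ^+ j * q ^+ 'C(j, 2) * qpoch q q (j + i).
Proof.
elim: j => [|j IH]; first by rewrite hpoch0 !mul1r.
have e : hpoch q (q ^+ (j.+1 + i)) (1 * q) j = q ^+ j * hpoch q (q ^+ (j + i)) 1 j.
  by rewrite addSn exprS [1 * q]mulrC hpochM.
rewrite hpochSl e.
rewrite addSn qpochS binS bin1 [q ^+ ('C(_, _) + _)]exprD !exprS.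
transitivity ((q * q ^+ (j + i) - 1) * q ^+ j * (hpoch q (q ^+ (j + i)) 1 j * qpoch q q i)).
  by ring.
by rewrite IH; ring.
Qed.

(** The points j <= k <= n, listed by k on the left and by i = k - j on the
    right. *)
Lemma exchange_triangle (f : nat -> nat -> K) n :
  \sum_(k < n.+1) \sum_(j < k.+1) f j (k - j)%N
    = \sum_(j < n.+1) \sum_(i < (n - j).+1) f j i.
Proof.
elim: n => [|n IH]; first by rewrite !big_ord1.
rewrite big_ord_recr IH [RHS]big_ord_recr /= subnn big_ord1.
rewrite [X in _ + X = _]big_ord_recr /= subnn addrA; congr (_ + _).
rewrite -big_split /=; apply: eq_bigr => j _.
by rewrite subSn ?[RHS]big_ord_recr //= -ltnS.
Qed.

Hypothesis qpoch_qq_neq0 : forall n, qpoch q q n != 0.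

Let one_sub_q n : 1 - q * q ^+ n != 0.
Proof.
by have := qpoch_qq_neq0 n.+1; rewrite qpochS mulf_eq0 negb_or => /andP[].
Qed.

(** The sum S_n satisfies (1 - c q^n) S_(n+1) = (b - c q^n) S_n.  The
    difference of the two summands telescopes, and the boundary term vanishes
    because it contains (q^-n; q)_(n+1). *)
Lemma qVandermonde b c n : (forall m, qpoch q c m != 0) ->
  \sum_(i < n.+1) qpoch q (q ^- n) i * qpoch q b i
      / (qpoch q q i * qpoch q c i) * q ^+ i
    = hpoch q b c n / qpoch q c n.
Proof.
move=> cP.
have cq m : 1 - c * q ^+ m != 0.
  by have := cP m.+1; rewrite qpochS mulf_eq0 negb_or => /andP[].
pose T n i := qpoch q (q ^- n) i * qpoch q b i
      / (qpoch q q i * qpoch q c i) * q ^+ i.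
rewrite -[LHS]/(\sum_(i < n.+1) T n i).
have WZ m M : (1 - c * q ^+ m) * (\sum_(i < M.+1) T m.+1 i)
    - (b - c * q ^+ m) * (\sum_(i < M.+1) T m i)
  = qpoch q (q ^- m) M * qpoch q b M.+1 / (qpoch q q M * qpoch q c M).
  elim: M => [|M IH].
    by rewrite !big_ord1 /T qpochS !qpoch0 !expr0; field.
  rewrite big_ord_recr [X in _ - _ * X]big_ord_recr /= !mulrDr opprD addrACA IH.
  have e : q ^- m.+1 * q = q ^- m by rewrite exprS invfM mulrAC mulVf // mul1r.
  rewrite /T [qpoch q (q ^- m.+1) _]qpochSl e !qpochS !exprS.
  have qm : q ^+ m != 0 by rewrite expf_neq0.
  have := qpoch_qq_neq0 M; have := cP M; have := one_sub_q M; have := cq M.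
  move: (q ^+ m) (q ^+ M) (qpoch q c M) (qpoch q q M) qm => y x C Q y0 cx qx C0 Q0.
  by field; rewrite y0 C0 Q0 cx qx q_neq0.
elim: n => [|n IH]; first by rewrite big_ord1 /T !qpoch0 !hpoch0 expr0; field.
have := WZ n n.+1.
have z : qpoch q (q ^- n) n.+1 = 0.
  by rewrite qpochS mulVf ?expf_neq0 // subrr mulr0.
rewrite z !mul0r [X in _ - _ * X]big_ord_recr /= IH => /eqP.
rewrite subr_eq0 {2}/T z !mul0r addr0 => /eqP e.
have cn := cq n; apply: (mulfI cn); rewrite e hpochS qpochS.
have Cn := cP n; field; rewrite cn; exact: Cn.
Qed.

(** The q-Chu-Vandermonde sum with argument b q^n, cleared of negative powers:
    it is 2phi1(q^-n, d/b; d; q, b q^n).  The same telescoping argument gives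
    (1 - d q^n) S_(n+1) = (1 - b q^n) S_n. *)
Lemma qVandermonde_dual b d n : (forall m, qpoch q d m != 0) ->
  \sum_(i < n.+1) hpoch q (q ^+ n) 1 i * hpoch q b d i
      / (qpoch q q i * qpoch q d i)
    = qpoch q b n / qpoch q d n.
Proof.
move=> dP.
have dq m : 1 - d * q ^+ m != 0.
  by have := dP m.+1; rewrite qpochS mulf_eq0 negb_or => /andP[].
pose T n i := hpoch q (q ^+ n) 1 i * hpoch q b d i / (qpoch q q i * qpoch q d i).
rewrite -[LHS]/(\sum_(i < n.+1) T n i).
have WZ m M : (1 - d * q ^+ m) * (\sum_(i < M.+1) T m.+1 i)
    - (1 - b * q ^+ m) * (\sum_(i < M.+1) T m i)
  = q ^+ m * hpoch q (q ^+ m) 1 M * hpoch q b d M.+1 / (qpoch q q M * qpoch q d M).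
  elim: M => [|M IH].
    by rewrite !big_ord1 /T hpochS !hpoch0 !qpoch0 !expr0; field.
  rewrite big_ord_recr [X in _ - _ * X]big_ord_recr /= !mulrDr opprD addrACA IH.
  have e : hpoch q (q ^+ m.+1) 1 M.+1 = (q ^+ m.+1 - 1) * (q ^+ M * hpoch q (q ^+ m) 1 M).
    by rewrite hpochSl mul1r -hpochM mulr1 exprS.
  rewrite /T e !hpochS !qpochS !exprS.
  have := qpoch_qq_neq0 M; have := dP M; have := one_sub_q M; have := dq M.
  move: (q ^+ m) (q ^+ M) (qpoch q d M) (qpoch q q M) => y x C Q cx qx C0 Q0.
  by field; rewrite C0 Q0 cx qx.
elim: n => [|n IH]; first by rewrite big_ord1 /T !qpoch0 !hpoch0; field.
have := WZ n n.+1.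
have z : hpoch q (q ^+ n) 1 n.+1 = 0 by rewrite hpochS mul1r subrr mulr0.
rewrite z mulr0 !mul0r [X in _ - _ * X]big_ord_recr /= IH => /eqP.
rewrite subr_eq0 {2}/T z !mul0r addr0 => /eqP e.
have cn := dq n; apply: (mulfI cn); rewrite e !qpochS.
have Cn := dP n; field; rewrite cn; exact: Cn.
Qed.

End QAlgebra.

Lemma bin2D m n : 'C(m + n, 2) = ('C(m, 2) + 'C(n, 2) + m * n)%N.
Proof.
elim: n => [|n IH]; first by rewrite bin0n !addn0 muln0 addn0.
by rewrite addnS !binS !bin1 IH; lia.
Qed.

(** * Transformation of the terminating 3phi2 *)

Section Transformation.
Variables (K : numFieldType) (q : K).
Implicit Types x y z a b c d alpha beta : K.
Implicit Types m n k : nat.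
Hypothesis q_neq0 : q != 0.
Hypothesis qpoch_qq_neq0 : forall n, qpoch q q n != 0.

Lemma qpoch_negpowD n j i : (j <= n)%N ->
  qpoch q (q ^- n) (j + i) = qpoch q (q ^- n) j * qpoch q (q ^- (n - j)) i.
Proof.
move=> jn; rewrite qpochD; congr (_ * qpoch q _ i).
by rewrite -{1}(subnK jn) exprD invfM divfK // expf_neq0.
Qed.

(** Expanding (beta; q)_k / (d; q)_k by [qVandermonde_dual] turns the left side
    into a sum over j <= k <= n.  For fixed j the sum over k is a
    q-Chu-Vandermonde sum of length n - j, and its value is the j-th term on
    the right. *)
Lemma sum_phi32_term_transform alpha beta c d n :
  beta != 0 -> c != 0 ->
  (forall m, qpoch q c m != 0) -> (forall m, qpoch q d m != 0) ->
  (forall m, qpoch q (q * alpha / c) m != 0) ->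
  \sum_(k < n.+1) phi32_term q (q ^- n) (alpha * q ^+ n) beta c d q k
    = qpoch q (q * alpha / c) n / qpoch q c n * (- c) ^+ n * q ^+ 'C(n, 2)
      * \sum_(k < n.+1) phi32_term q (q ^- n) (alpha * q ^+ n) (d / beta) d
          (q * alpha / c) (q * beta / c) k.
Proof.
move=> b0 c0 cP dP eP.
pose X k := qpoch q (q ^- n) k * qpoch q (alpha * q ^+ n) k
  / (qpoch q q k * qpoch q c k) * q ^+ k.
pose f j i := X (j + i)%N * (hpoch q (q ^+ (j + i)) 1 j * hpoch q beta d j
  / (qpoch q q j * qpoch q d j)).
transitivity (\sum_(k < n.+1) \sum_(j < k.+1) f j (k - j)%N).
  apply: eq_bigr => k _.
  have -> : phi32_term q (q ^- n) (alpha * q ^+ n) beta c d q k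
      = X k * (qpoch q beta k / qpoch q d k).
    rewrite /phi32_term /X /qpochs !big_cons !big_nil !mulr1.
    by field; rewrite qpoch_qq_neq0 cP dP.
  rewrite -(qVandermonde_dual qpoch_qq_neq0) // mulr_sumr; apply: eq_bigr => j _.
  by rewrite /f subnKC // -ltnS.
rewrite exchange_triangle mulr_sumr; apply: eq_bigr => -[j /= jn] _.
rewrite ltnS in jn.
have cqP m : qpoch q (c * q ^+ j) m != 0.
  by have := cP (j + m)%N; rewrite qpochD mulf_eq0 negb_or => /andP[].
(* C collects what does not depend on i = k - j. *)
pose C := qpoch q (q ^- n) j * qpoch q (alpha * q ^+ n) j * q ^+ j * (-1) ^+ j
  * q ^+ 'C(j, 2) * hpoch q beta d j / (qpoch q c j * qpoch q q j * qpoch q d j).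
transitivity (C * (hpoch q (alpha * q ^+ n * q ^+ j) (c * q ^+ j) (n - j)
    / qpoch q (c * q ^+ j) (n - j))).
  rewrite -qVandermonde // mulr_sumr; apply: eq_bigr => i _.
  rewrite /f /X.
  have -> : hpoch q (q ^+ (j + i)) 1 j = (-1) ^+ j * q ^+ 'C(j, 2) *
      qpoch q q (j + i) / qpoch q q i by rewrite -hpoch_qpow mulfK.
  rewrite qpoch_negpowD // !(qpochD _ _ j i) exprD /C.
  have := qpoch_qq_neq0 (j + i)%N; rewrite qpochD mulf_eq0 negb_or => /andP[Q1 Q2].
  by field; rewrite Q1 Q2 !qpoch_qq_neq0 !cP !cqP !dP.
rewrite {}/C; have [m ->] : exists m, n = (j + m)%N by exists (n - j)%N; rewrite subnKC.
rewrite addKn.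
have -> : alpha * q ^+ (j + m) * q ^+ j = q ^+ j * (alpha * q ^+ j * q ^+ m).
  by rewrite exprD; ring.
rewrite [c * q ^+ j]mulrC hpochM hpoch_rev // [q ^+ j * c]mulrC.
rewrite /phi32_term /qpochs !big_cons !big_nil !mulr1.
rewrite (hpoch_qpoch q d j b0) !(qpochD _ _ j m) bin2D !exprD !exprMn !exprVn.
have -> : q * (alpha * q ^+ j) / c = q * alpha / c * q ^+ j by ring.
have := eP (j + m)%N; rewrite qpochD mulf_eq0 negb_or => /andP[E1 E2].
rewrite -[- c]mulN1r !exprMn exprM.
have cj : c ^+ j != 0 by rewrite expf_neq0.
field.
by rewrite !cP !cqP !qpoch_qq_neq0 !dP E1 cj.
Qed.

(** Unless k = m = 0, both sides are
    (1 - alpha q^(2(k+m))) (alpha q; q)_(2k+m-1). *)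
Lemma vwp_factor_shift alpha k m :
  vwp_factor q alpha (k + m) * qpoch q (alpha * q ^+ (k + m)) k
    = qpoch q (alpha * q) (2 * k) * vwp_factor q (alpha * q ^+ (2 * k)) m.
Proof.
have e j : alpha * q ^+ j.+1 = alpha * q * q ^+ j by rewrite exprS mulrA.
case: m => [|m].
  rewrite addn0 mulr1; case: k => [|k]; first by rewrite muln0 !qpoch0 mulr1.
  rewrite /vwp_factor -mulrA (e k) -qpochD mulrC.
  by rewrite (_ : (2 * k.+1)%N = (k + k.+1).+1) ?qpochS ?e //; lia.
rewrite addnS /vwp_factor -[LHS]mulrA (e (k + m)%N) -qpochD [RHS]mulrCA.
have -> : alpha * q ^+ (2 * k) * q = alpha * q * q ^+ (2 * k) by ring.
rewrite -qpochD -[alpha * _ * _ in RHS]mulrA -exprD.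
by congr ((1 - _ * q ^+ _) * qpoch _ _ _); lia.
Qed.

(** The term of the very-well-poised 6phi5 series with parameters q/a, q/b and
    a third one sent to infinity. *)
Definition vwp_term (K : numFieldType) (q alpha a b : K) (m : nat) : K :=
  vwp_factor q alpha m * qpoch_shift q a m * qpoch_shift q b m
    * (- (alpha / q)) ^+ m * q ^+ 'C(m, 2)
    / (qpoch q q m * qpoch q (alpha * a) m * qpoch q (alpha * b) m).

(** With t_m the m-th term and x = q^m, the m-th summand of the left side is
    g_(m+1) - g_m for
      g_m = - (1 - alpha a) (1 - alpha b) t_m (1 - x) / (1 - alpha x^2).
    The factor 1 - alpha x^2 of t_m cancels, and g_0 = 0; the right side is
    g_(n+1). *)
Lemma vwp_term_telescope alpha a b n :
  (forall m, qpoch q (alpha * a) m != 0) ->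
  (forall m, qpoch q (alpha * b) m != 0) ->
  (1 - alpha * a) * (1 - alpha * b) * \sum_(m < n.+1) vwp_term q alpha a b m
  - (1 - alpha * q) * (1 - alpha * a * b / q)
      * \sum_(m < n.+1) vwp_term q (alpha * q) a b m
  = - ((1 - alpha * a) * (1 - alpha * b) * qpoch q (alpha * q) n
      * qpoch_shift q a n.+1 * qpoch_shift q b n.+1
      * (- (alpha / q)) ^+ n.+1 * q ^+ 'C(n.+1, 2)
      / (qpoch q q n * qpoch q (alpha * a) n.+1 * qpoch q (alpha * b) n.+1)).
Proof.
move=> aP bP.
have a1 : 1 - alpha * a != 0 by have := aP 1%N; rewrite qpochS qpoch0 mul1r expr0 mulr1.
have b1 : 1 - alpha * b != 0 by have := bP 1%N; rewrite qpochS qpoch0 mul1r expr0 mulr1.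
have shS x m : qpoch_shift q x m.+1 = qpoch_shift q x m * (x - q * q ^+ m).
  by rewrite !qpoch_shift_hpoch hpochS.
have sh0 x : qpoch_shift q x 0 = 1 by rewrite qpoch_shift_hpoch hpoch0.
elim: n => [|n IH].
  rewrite !big_ord1 /vwp_term !shS !sh0 !qpochS !qpoch0 /= !expr0.
  by field; rewrite q_neq0 a1 b1.
rewrite big_ord_recr [X in _ - _ * X]big_ord_recr /=.
rewrite [_ * (\sum_(m < n.+1) vwp_term q alpha a b m + _)]mulrDr.
rewrite [_ * (\sum_(m < n.+1) vwp_term q (alpha * q) a b m + _)]mulrDr.
rewrite opprD addrACA IH.
rewrite /vwp_term /vwp_factor.
have E x : alpha * q * x = alpha * x * q by ring.
have qq m x : 1 - x != 0 -> qpoch q (x * q) m = qpoch q x m.+1 / (1 - x).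
  by move=> x1; rewrite qpochSl mulrAC divff ?mul1r.
have Ea : qpoch q (alpha * q * a) n.+1 = qpoch q (alpha * a) n.+2 / (1 - alpha * a).
  by rewrite E qq.
have Eb : qpoch q (alpha * q * b) n.+1 = qpoch q (alpha * b) n.+2 / (1 - alpha * b).
  by rewrite E qq.
rewrite Ea Eb.
have -> : (1 - alpha * q) * (1 - alpha * a * b / q) *
   ((1 - alpha * q * q ^+ (2 * n.+1)) * qpoch q (alpha * q * q) n *
    qpoch_shift q a n.+1 * qpoch_shift q b n.+1 * (- (alpha * q / q)) ^+ n.+1 *
    q ^+ 'C(n.+1, 2) /
    (qpoch q q n.+1 * (qpoch q (alpha * a) n.+2 / (1 - alpha * a)) *
     (qpoch q (alpha * b) n.+2 / (1 - alpha * b)))) =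
   (1 - alpha * a * b / q) *
   ((1 - alpha * q * q ^+ (2 * n.+1)) * ((1 - alpha * q) * qpoch q (alpha * q * q) n) *
    qpoch_shift q a n.+1 * qpoch_shift q b n.+1 * ((- (alpha / q)) ^+ n.+1 * q ^+ n.+1) *
    q ^+ 'C(n.+1, 2) /
    (qpoch q q n.+1 * (qpoch q (alpha * a) n.+2 / (1 - alpha * a)) *
     (qpoch q (alpha * b) n.+2 / (1 - alpha * b)))).
  have -> : (- (alpha * q / q)) ^+ n.+1 = (- (alpha / q)) ^+ n.+1 * q ^+ n.+1.
    by rewrite -exprMn mulNr [alpha * q / q]mulrAC.
  by move: (_ * (_ / _) * (_ / _)) => D; ring.
rewrite -qpochSl (binS n.+1) bin1 exprD (shS a n.+1) (shS b n.+1).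
rewrite (qpochS _ (alpha * a) n.+1) (qpochS _ (alpha * b) n.+1).
rewrite (qpochS _ q) (qpochS _ (alpha * q)) (exprS _ n.+1).
have -> : q ^+ (2 * n.+1) = q ^+ n.+1 ^+ 2 by rewrite -exprM mulnC.
rewrite !exprS.
have := aP n.+2; have := bP n.+2.
rewrite (qpochS _ (alpha * a) n.+1) (qpochS _ (alpha * b) n.+1) !mulf_eq0 !negb_or !exprS.
move=> /andP[B B'] /andP[A A'].
have := qpoch_qq_neq0 n.+1; rewrite qpochS !mulf_eq0 !negb_or.
move=> /andP[Q Q'].
move: (qpoch_shift q a n.+1) (qpoch_shift q b n.+1) => sa sb.
move: (qpoch q (alpha * q) n) ((- (alpha / q)) ^+ n) (q ^+ _) => V w t.
move: (qpoch q (alpha * a) n.+1) (qpoch q (alpha * b) n.+1) (qpoch q q n) (q ^+ n) A A' B B' Q Q' => A B Q x *.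
by field; do ?[apply/andP; split].
Qed.

Lemma qpoch_shiftD a k m :
  qpoch_shift q a (k + m)
    = qpoch_shift q a k * q ^+ (k * m) * qpoch_shift q (a / q ^+ k) m.
Proof.
rewrite !qpoch_shift_hpoch; elim: m => [|m IH].
  by rewrite addn0 hpoch0 muln0 !mulr1.
rewrite addnS !hpochS IH mulnS !exprD.
have qk : q ^+ k != 0 by rewrite expf_neq0.
by field.
Qed.

(** The powers q^-(k+m) inside (q^-(k+m); q)_k and the argument
    q^k cancel all of q^C(k+m, 2) but q^C(m, 2).  In this form every factor but
    (alpha/q)^(k+m) and the two shifted products of length k + m is bounded,
    which is how the double sum gets its geometric majorant. *)
Lemma vwp_term_phi32_term alpha a b beta c d k m :
  (forall m, qpoch q (alpha * a) m != 0) ->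
  (forall m, qpoch q (alpha * b) m != 0) ->
  (forall m, qpoch q c m != 0) -> (forall m, qpoch q d m != 0) ->
  vwp_term q alpha a b (k + m)
    * phi32_term q (q ^- (k + m)) (alpha * q ^+ (k + m)) beta c d q k
  = qpoch q beta k / (qpoch q q k * qpoch q c k * qpoch q d k)
    * (qpoch q (alpha * q) (2 * k) * vwp_factor q (alpha * q ^+ (2 * k)) m)
    * (qpoch_shift q a (k + m) * qpoch_shift q b (k + m) * (alpha / q) ^+ (k + m))
    * ((- 1) ^+ m * q ^+ 'C(m, 2)
      / (qpoch q q m * qpoch q (alpha * a) (k + m) * qpoch q (alpha * b) (k + m))).
Proof.
move=> aP bP cP dP; rewrite -vwp_factor_shift.
rewrite /phi32_term /vwp_term /qpochs !big_cons !big_nil !mulr1.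
have := hpoch_qpow q k m; rewrite hpoch_qpoch ?expf_neq0 // mul1r => e.
have qk : q ^+ (k + m) ^+ k != 0 by rewrite !expf_neq0.
have -> : qpoch q (q ^- (k + m)) k = 
  (-1) ^+ k * q ^+ 'C(k, 2) * qpoch q q (k + m) / (q ^+ (k + m) ^+ k * qpoch q q m).
  by rewrite -e; field; rewrite qk qpoch_qq_neq0.
rewrite -(mulN1r (alpha / q)) exprMn.
have -> : (-1) ^+ (k + m) = (-1) ^+ k * (-1) ^+ m :> K by rewrite exprD.
have -> : q ^+ 'C(k + m, 2) = q ^+ 'C(m, 2) * q ^+ (k + m) ^+ k / (q ^+ 'C(k, 2) * q ^+ k).
  have kk : ('C(k, 2) + 'C(k, 2) + k = k * k)%N.
    by elim: (k) => // j IH; rewrite binS bin1; lia.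
  apply: (mulIf (_ : q ^+ 'C(k, 2) * q ^+ k != 0)); first by rewrite mulf_neq0 ?expf_neq0.
  rewrite divfK ?mulf_neq0 ?expf_neq0 // -exprM -!exprD; congr (q ^+ _).
  by rewrite bin2D; lia.
(* Two factors (-1)^k cancel once one of them is written as an inverse. *)
rewrite -[X in X * q ^+ 'C(k, 2) * _]invr_sign.
have s0 : (-1) ^+ k != 0 :> K by rewrite signr_eq0.
have q1 : q ^+ k != 0 by rewrite expf_neq0.
have q2 : q ^+ 'C(k, 2) != 0 by rewrite expf_neq0.
move: (q ^+ (k + m) ^+ k) qk => X X0.
by field; rewrite X0 s0 q1 q2 !qpoch_qq_neq0 !aP !bP !cP !dP.
Qed.
End Transformation.

(** * The double sum behind the expansion *)

Section Rearrangement.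
Variables (K : numFieldType) (q : K).
Implicit Types x y z a b c d alpha beta : K.
Implicit Types m n k : nat.
Hypothesis q_neq0 : q != 0.
Hypothesis qpoch_qq_neq0 : forall n, qpoch q q n != 0.

(** For fixed k the terms are a multiple of those of the same very-well-poised
    series at (alpha q^(2k), a q^-k, b q^-k); this shift leaves alpha a b
    unchanged. *)
Lemma vwp_term_phi32_row alpha a b beta c d k m :
  (forall m, qpoch q (alpha * a) m != 0) ->
  (forall m, qpoch q (alpha * b) m != 0) ->
  (forall m, qpoch q c m != 0) -> (forall m, qpoch q d m != 0) ->
  vwp_term q alpha a b (k + m)
    * phi32_term q (q ^- (k + m)) (alpha * q ^+ (k + m)) beta c d q k
  = phi32_shift_term q a b beta c d alpha k
    * (qpoch q (alpha * q) (2 * k) / (qpoch q (alpha * a) k * qpoch q (alpha * b) k))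
    * vwp_term q (alpha * q ^+ (2 * k)) (a / q ^+ k) (b / q ^+ k) m.
Proof.
move=> aP bP cP dP; rewrite vwp_term_phi32_term // !qpoch_shiftD // !qpochD.
rewrite /phi32_shift_term /vwp_term /qpochs !big_cons !big_nil !mulr1.
have q1 : q ^+ k != 0 by rewrite expf_neq0.
have E x : alpha * q ^+ (2 * k) * (x / q ^+ k) = alpha * x * q ^+ k.
  by rewrite mulnC exprM; field.
rewrite !E.
have -> : (- (alpha * q ^+ (2 * k) / q)) ^+ m
    = (-1) ^+ m * (alpha / q) ^+ m * q ^+ (k * m) * q ^+ (k * m).
  by rewrite (mulnC 2) !exprM -!exprMn; congr (_ ^+ m); field.
rewrite exprD.
have := aP (k + m)%N; rewrite qpochD mulf_eq0 negb_or => /andP[A A'].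
have := bP (k + m)%N; rewrite qpochD mulf_eq0 negb_or => /andP[B B'].
move: ((alpha / q) ^+ k) ((alpha / q) ^+ m) => u v.
by field; rewrite !qpoch_qq_neq0 A A' B B' !cP !dP.
Qed.

Lemma expansion_termE alpha a b beta c d n :
  beta != 0 -> c != 0 ->
  (forall m, qpoch q (alpha * a) m != 0) ->
  (forall m, qpoch q (alpha * b) m != 0) ->
  (forall m, qpoch q c m != 0) -> (forall m, qpoch q d m != 0) ->
  (forall m, qpoch q (q * alpha / c) m != 0) ->
  vwp_factor q alpha n * qpoch_shift q a n * qpoch_shift q b n
        * qpoch q (q * alpha / c) n
        * (alpha * c) ^+ n * q ^ (n%:Z ^+ 2 - 2 * n%:Z)
      / qpochs q [:: q; alpha * a; alpha * b; c] n
      * phi32 q (q ^- n) (alpha * q ^+ n) (d / beta) d (q * alpha / c)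
          (q * beta / c)
  = \sum_(k < n.+1) vwp_term q alpha a b n
      * phi32_term q (q ^- n) (alpha * q ^+ n) beta c d q k.
Proof.
move=> b0 c0 aP bP cP dP eP.
rewrite -mulr_sumr sum_phi32_term_transform // phi32_terminating // big_mkord.
rewrite [RHS]mulrA; congr (_ * _).
rewrite /vwp_term /qpochs !big_cons !big_nil !mulr1.
rewrite -[_ * (alpha * c) ^+ n * _]mulrA.
have -> : (alpha * c) ^+ n * q ^ (n%:Z ^+ 2 - 2 * n%:Z)
    = (- (alpha / q)) ^+ n * q ^+ 'C(n, 2) * ((- c) ^+ n * q ^+ 'C(n, 2)).
  rewrite mulrACA -exprMn -exprD mulrNN mulrAC [(alpha * c / q) ^+ n]exprMn [q^-1 ^+ n]exprVn.
  have -> : ('C(n, 2) + 'C(n, 2) = n * n.-1)%N.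
    by elim: (n) => // -[//|j] IH; rewrite binS bin1; move: IH => /=; lia.
  rewrite -mulrA; congr (_ * _); apply: (mulIf (_ : q ^+ n != 0)).
    by rewrite expf_neq0.
  rewrite [RHS]mulrAC mulVf ?expf_neq0 // mul1r ![q ^+ _]exprnP -expfzDr //.
  by congr (q ^ _); case: (n) => // j /=; rewrite -natz; lia.
move: ((- (alpha / q)) ^+ n) ((- c) ^+ n) => u v.
by field; rewrite qpoch_qq_neq0 aP bP cP.
Qed.
End Rearrangement.

(** * Series of complex numbers with geometric majorants *)

Section ComplexSeries.
Variable R : realType.
Local Notation C := (Num.NumField.sort (R[i] : numFieldType)).
Implicit Types (z w l : C) (u : nat -> C).

(** The modulus as an element of R, where the order is total and the geometric
    series is available. *)
Definition cnorm (z : C) : R := complex.Re `|z|.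

Lemma cnormE z : `|z| = (cnorm z)%:C.
Proof. by rewrite /cnorm normc_def. Qed.

Lemma cnorm_ge0 z : 0 <= cnorm z.
Proof. by rewrite -lecR -cnormE normr_ge0. Qed.

Lemma cnormM z w : cnorm (z * w) = cnorm z * cnorm w.
Proof. by rewrite {1}/cnorm normrM !cnormE -rmorphM. Qed.

Lemma cnormV z : cnorm z^-1 = (cnorm z)^-1.
Proof. by rewrite {1}/cnorm normfV cnormE -fmorphV. Qed.

Lemma cnormX z n : cnorm (z ^+ n) = cnorm z ^+ n.
Proof. by rewrite {1}/cnorm normrX cnormE -rmorphXn. Qed.

Lemma cnormN z : cnorm (- z) = cnorm z.
Proof. by rewrite /cnorm normrN. Qed.

Lemma cnormB z w : cnorm (z - w) = cnorm (w - z).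
Proof. by rewrite -cnormN opprB. Qed.

Lemma cnormD z w : cnorm (z + w) <= cnorm z + cnorm w.
Proof. by rewrite -lecR rmorphD /= -!cnormE ler_normD. Qed.

Lemma cnorm1 : cnorm 1 = 1.
Proof. by rewrite /cnorm normr1. Qed.

Lemma cnorm0 : cnorm 0 = 0.
Proof. by rewrite /cnorm normr0. Qed.

Lemma cnorm_gt0 z : (0 < cnorm z) = (z != 0).
Proof. by rewrite -ltcR -cnormE normr_gt0. Qed.

Lemma cnorm_real (r : R) : 0 <= r -> cnorm r%:C = r.
Proof. by move=> r0; rewrite /cnorm ger0_norm // lecR. Qed.

Lemma cnorm_sum (I : Type) (s : seq I) (P : pred I) (F : I -> C) :
  cnorm (\sum_(i <- s | P i) F i) <= \sum_(i <- s | P i) cnorm (F i).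
Proof.
elim/big_ind2 : _ => [|z x w y zx wy|//]; first by rewrite cnorm0.
exact: le_trans (cnormD _ _) (lerD zx wy).
Qed.

Lemma Re_le_cnorm z : `|complex.Re z| <= cnorm z.
Proof. by rewrite -lecR -cnormE normc_ge_Re. Qed.

Lemma Im_le_cnorm z : `|complex.Im z| <= cnorm z.
Proof. 
have := Re_le_cnorm (z * 'i); rewrite ReiNIm normrN cnormM => h.
by apply: le_trans h _; rewrite {2}/cnorm normc_def /= expr0n expr1n add0r sqrtr1 mulr1.
Qed.

Lemma cnorm_le_ReIm z : cnorm z <= `|complex.Re z| + `|complex.Im z|.
Proof.
rewrite /cnorm normc_def /= -[X in _ <= X]ger0_norm ?addr_ge0 // -sqrtr_sqr.
rewrite ler_wsqrtr // -[complex.Re z ^+ 2]real_normK ?num_real //.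
rewrite -[complex.Im z ^+ 2]real_normK ?num_real //.
by rewrite sqrrD addrAC lerDl mulrn_wge0 // mulr_ge0.
Qed.

Lemma cvgC_dominated u l (e : nat -> R) :
  (forall n, cnorm (u n - l) <= e n) -> e @ \oo --> 0 -> u @ \oo --> l.
Proof.
move=> ue e0; apply/cvgrPdist_lt => eps; rewrite ltcE /= => /andP[/eqP i0 r0].
have /cvgrPdist_lt /(_ _ r0) := e0; apply: filterS => n.
rewrite sub0r normrN => h.
rewrite distrC cnormE ltcE /= -i0 eqxx /=.
exact: le_lt_trans (ue n) (le_lt_trans (ler_norm _) h).
Qed.

Lemma cvgC_cnorm u l : u @ \oo --> l -> (fun n => cnorm (u n - l)) @ \oo --> 0.
Proof.
move=> ul; apply/cvgrPdist_lt => eps e0.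
have e0' : 0 < eps%:C by rewrite ltcR.
have /cvgrPdist_lt /(_ _ e0') := ul; apply: filterS => n.
by rewrite cnormE ltcR sub0r normrN ger0_norm ?cnorm_ge0 // cnormB.
Qed.

Lemma cvgC_unique u l (l' : C) : u @ \oo --> l -> u @ \oo --> l' -> l = l'.
Proof.
move=> h h'; rewrite -(cvg_lim (@norm_hausdorff _ _) h).
by rewrite -(cvg_lim (@norm_hausdorff _ _) h').
Qed.

Lemma cvgC_shiftS u l : u @ \oo --> l -> (fun n => u n.+1) @ \oo --> l.
Proof. by move=> h; have := @cvg_shiftS C u (nbhs l) => ->. Qed.

Lemma cvgC_ext u (v : nat -> C) l :
  (forall n, u n = v n) -> u @ \oo --> l -> v @ \oo --> l.
Proof. by move=> /funext ->. Qed.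

Lemma Re_sum (s : seq nat) (F : nat -> C) :
  complex.Re (\sum_(i <- s) F i) = \sum_(i <- s) complex.Re (F i).
Proof.
elim: s => [|i s IH]; rewrite ?big_nil ?big_cons // -IH.
by case: (F i) => ? ?; case: (\sum_(_ <- s) _).
Qed.

Lemma Im_sum (s : seq nat) (F : nat -> C) :
  complex.Im (\sum_(i <- s) F i) = \sum_(i <- s) complex.Im (F i).
Proof.
elim: s => [|i s IH]; rewrite ?big_nil ?big_cons // -IH.
by case: (F i) => ? ?; case: (\sum_(_ <- s) _).
Qed.

Lemma geometric_tail_le (M r : R) m n : 0 <= M -> 0 <= r < 1 ->
  \sum_(m <= k < n) M * r ^+ k <= M * r ^+ m / (1 - r).
Proof.
move=> M0 /andP[r0 r1]; have r1' : 0 < 1 - r by rewrite subr_gt0.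
have [nm|/ltnW mn] := leqP n m.
  by rewrite big_geq // divr_ge0 ?mulr_ge0 ?exprn_ge0 // ltW.
rewrite -mulr_sumr -mulrA ler_wpM2l // ler_pdivlMr //.
have : \sum_(m <= k < n) r ^+ k * (1 - r) = r ^+ m - r ^+ n.
  rewrite -(opprB (r ^+ n)) -telescope_sumr // -sumrN; apply: eq_bigr => k _.
  by rewrite exprS opprB mulrBr mulr1 [r ^+ k * r]mulrC.
by rewrite mulr_suml => ->; rewrite gerBl exprn_ge0.
Qed.

(** Completeness of R is used on the real and imaginary parts separately. *)
Lemma cvg_series_geometric_bound u (M r : R) :
  0 <= r < 1 -> (forall n, cnorm (u n) <= M * r ^+ n) ->
  exists l, series u @ \oo --> l.
Proof.
move=> r01 uM; have M0 : 0 <= M.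
  by have := uM 0%N; rewrite expr0 mulr1; apply: le_trans (cnorm_ge0 _).
have geo : cvgn (series (geometric M r)).
  by apply: is_cvg_geometric_series; rewrite ger0_norm //; case/andP: r01.
have real_cvg (v : nat -> R) : (forall n, `|v n| <= M * r ^+ n) -> cvgn (series v).
  move=> vM; apply: normed_cvg; apply: series_le_cvg geo => n /=; [exact: normr_ge0| |exact: vM].
  by case/andP: r01 => *; rewrite mulr_ge0 ?exprn_ge0.
have /cvg_ex[/= x cx] := real_cvg (fun n => complex.Re (u n)) (fun n => le_trans (Re_le_cnorm _) (uM n)).
have /cvg_ex[/= y cy] := real_cvg (fun n => complex.Im (u n)) (fun n => le_trans (Im_le_cnorm _) (uM n)).
exists (x +i* y).
apply: (@cvgC_dominated _ _ (fun n => `|series (fun n => complex.Re (u n)) n - x| + `|series (fun n => complex.Im (u n)) n - y|)).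
  move=> n; apply: le_trans (cnorm_le_ReIm _) _.
  rewrite /series /= -Re_sum -Im_sum.
  by case: (\sum_(0 <= k < n) u k).
rewrite -[X in _ --> X]addr0.
by apply: cvgD; apply/norm_cvg0P/subr_cvg0.
Qed.

Lemma series_tail_le u l (M r : R) n :
  0 <= r < 1 -> (forall n, cnorm (u n) <= M * r ^+ n) -> series u @ \oo --> l ->
  cnorm (l - series u n) <= M * r ^+ n / (1 - r).
Proof.
move=> r01 uM ul; have M0 : 0 <= M.
  by have := uM 0%N; rewrite expr0 mulr1; apply: le_trans (cnorm_ge0 _).
apply/ler_addgt0Pr => e e0.
have /cvgrPdist_lt /(_ _ e0) [N _ NP] := cvgC_cnorm ul.
have := NP (maxn N n) (leq_maxl _ _); rewrite /= sub0r normrN ger0_norm ?cnorm_ge0 // => h.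
have -> : l - series u n = (series u (maxn N n) - series u n) - (series u (maxn N n) - l).
  by ring.
apply: le_trans (cnormD _ _) _; rewrite cnormN; apply: lerD (ltW h).
rewrite sub_series_geq ?leq_maxr //; apply: le_trans (cnorm_sum _ _ _) _.
apply: le_trans (geometric_tail_le n (maxn N n) M0 r01).
by apply: ler_sum => k _.
Qed.

End ComplexSeries.

(** * Summation along diagonals *)

Section Triangle.
Variable R : realType.
Local Notation C := (Num.NumField.sort (R[i] : numFieldType)).

(** With s = sqrt r, n s^n <= 1 + s + ... + s^(n-1) <= 1/(1 - s), so
    n r^n <= s^n / (1 - s). *)
Lemma cvg_natM_expr (r : R) : 0 <= r < 1 -> (fun n => n%:R * r ^+ n) @ \oo --> 0.
Proof.
move=> /andP[r0 r1]; pose s := Num.sqrt r.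
have s0 : 0 <= s by exact: sqrtr_ge0.
have s1 : s < 1 by rewrite -sqrtr1 ltr_sqrt.
have ss : s * s = r by rewrite -expr2 sqr_sqrtr.
have cs : (fun n => (1 - s)^-1 * s ^+ n) @ \oo --> 0.
  by apply: (cvg_geometric (1 - s)^-1); rewrite ger0_norm.
apply: (@squeeze_cvgr _ _ _ _ (fun=> 0) (fun n => (1 - s)^-1 * s ^+ n)) => //; last exact: cvg_cst.
apply: nearW => n; rewrite mulr_ge0 ?exprn_ge0 //=.
rewrite -ss exprMn mulrA ler_wpM2r ?exprn_ge0 //.
have := @geometric_tail_le R 1 s 0 n ler01; rewrite s0 s1 => /(_ isT).
rewrite expr0 mulr1 mul1r; apply: le_trans.
have -> : n%:R * s ^+ n = \sum_(0 <= k < n) s ^+ n.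
  by rewrite sumr_const_nat subn0 mulr_natl.
apply: ler_sum_nat => k /andP[_ kn].
by rewrite mul1r; apply: ler_wiXn2l => //; [exact: ltW|exact: ltnW].
Qed.

(** The partial sum over k + m < N misses from row k < N the tail m >= N - k,
    which is at most M r^k r^(N-k) / (1 - r).  The N tails together are
    N M r^N / (1 - r), which tends to 0. *)
Lemma cvg_series_triangle (f : nat -> nat -> C) (F : nat -> C) (L : C) (M r : R) :
  0 <= r < 1 -> (forall k m, cnorm (f k m) <= M * r ^+ (k + m)) ->
  (forall k, series (f k) @ \oo --> F k) -> series F @ \oo --> L ->
  series (fun n => \sum_(k < n.+1) f k (n - k)%N) @ \oo --> L.
Proof.
move=> r01 fM fF FL.
have rows N : series (fun n => \sum_(k < n.+1) f k (n - k)%N) N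
    = \sum_(0 <= k < N) series (f k) (N - k)%N.
  case: N => [|N]; first by rewrite /series /= !big_geq.
  rewrite /series /= !big_mkord exchange_triangle.
  by apply: eq_bigr => -[j /= jN] _; rewrite subSn // big_mkord.
have M0 : 0 <= M.
  by have := fM 0%N 0%N; rewrite expr0 mulr1; apply: le_trans (cnorm_ge0 _).
apply: (@cvgC_dominated _ _ _
  (fun N => M / (1 - r) * (N%:R * r ^+ N) + cnorm (series F N - L))).
  move=> N; rewrite rows.
  have -> : \sum_(0 <= k < N) series (f k) (N - k)%N - L
    = \sum_(0 <= k < N) (series (f k) (N - k)%N - F k) + (series F N - L).
    by rewrite sumrB addrA subrK.
  apply: le_trans (cnormD _ _) _; rewrite lerD2r.
  apply: le_trans (cnorm_sum _ _ _) _.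
  have -> : M / (1 - r) * (N%:R * r ^+ N) = \sum_(0 <= k < N) (M * r ^+ N / (1 - r)).
    by rewrite sumr_const_nat subn0 -mulr_natl; ring.
  apply: ler_sum_nat => k /andP[_ kN]; rewrite cnormB.
  apply: le_trans (@series_tail_le _ _ _ (M * r ^+ k) r _ r01 _ (fF k)) _.
    by move=> m; rewrite -mulrA -exprD.
  by rewrite -[M * _ * _]mulrA -exprD subnKC // ltnW.
rewrite -[X in _ --> X]addr0; apply: cvgD; last exact: cvgC_cnorm.
by rewrite -[X in _ --> X](mulr0 (M / (1 - r))); apply: cvgMr; exact: cvg_natM_expr.
Qed.

(** The big-O relation over the whole index set, not only eventually; it is
    stable under products, and so gives bounds for the long quotients below
    factor by factor. *)
Definition dominated (I : Type) (u : I -> C) (g : I -> R) :=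
  exists M, forall i, cnorm (u i) <= M * g i.

Lemma dominatedM I (u v : I -> C) g h :
  dominated u g -> dominated v h -> dominated (u \* v) (g \* h).
Proof.
move=> [M uM] [N vN]; exists (M * N) => i; rewrite /= cnormM.
by rewrite mulrACA ler_pM ?cnorm_ge0.
Qed.

Lemma dominated_comp I J (p : I -> J) (u : J -> C) g :
  dominated u g -> dominated (u \o p) (g \o p).
Proof. by move=> [M uM]; exists M => i; exact: uM. Qed.

End Triangle.

(** * Bounds for q-products and their limits *)

Section Bounds.
Variable R : realType.
Local Notation C := (Num.NumField.sort (R[i] : numFieldType)).
Variable q0 : R.
Hypothesis q01 : 0 < q0 < 1.
Let q : C := q0%:C.
Implicit Types x y z a b : C.

Lemma q0_gt0 : 0 < q0. Proof. by case/andP: q01. Qed.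
Lemma q0_01 : 0 <= q0 < 1. Proof. by case/andP: q01 => /ltW -> ->. Qed.

Lemma cnorm_qX n : cnorm (q ^+ n) = q0 ^+ n.
Proof. by rewrite cnormX cnorm_real // ltW // q0_gt0. Qed.

Lemma q_neq0 : q != 0.
Proof. by rewrite -cnorm_gt0 cnorm_real ?q0_gt0 // ltW // q0_gt0. Qed.

Lemma qpoch_qq_neq0 n : qpoch q q n != 0.
Proof.
apply/prodf_neq0 => k _; rewrite subr_eq0 eq_sym -exprS; apply/negP => /eqP e.
have := cnorm_qX k.+1; rewrite e cnorm1 => /eqP.
by rewrite eq_sym lt_eqF // exprn_ilt1 ?(andP q0_01).1 ?(andP q0_01).2.
Qed.

(** |x - y q^k| <= A (1 + (Y/A) q^k) <= A exp((Y/A) q^k), and the exponents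
    sum to at most (Y/A) / (1 - q). *)
Lemma cnorm_hpoch_le (A Y : R) x y n : 0 < A -> cnorm x <= A -> cnorm y <= Y ->
  cnorm (hpoch q x y n) <= expR (Y / A / (1 - q0)) * A ^+ n.
Proof.
move=> A0 xA yY; have Y0 : 0 <= Y := le_trans (cnorm_ge0 _) yY.
apply: (@le_trans _ _ (expR (\sum_(0 <= k < n) Y / A * q0 ^+ k) * A ^+ n)).
  elim: n => [|n IH]; first by rewrite hpoch0 cnorm1 big_geq // expR0 mulr1.
  rewrite hpochS cnormM big_nat_recr //= expRD exprSr mulrACA.
  apply: ler_pM; rewrite ?cnorm_ge0 //.
  apply: le_trans (cnormD _ _) _; rewrite cnormN cnormM cnorm_qX.
  apply: (@le_trans _ _ ((1 + Y / A * q0 ^+ n) * A)); last first.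
    by rewrite ler_wpM2r ?expR_ge1Dx // ltW.
  rewrite mulrDl mul1r; apply: lerD => //.
  rewrite mulrAC divfK ?gt_eqF // ler_wpM2r ?exprn_ge0 //; exact: (andP q0_01).1.
rewrite ler_wpM2r ?exprn_ge0 ?(ltW A0) // ler_expR.
have YA : 0 <= Y / A by rewrite divr_ge0 // ltW.
by have := geometric_tail_le 0 n YA q0_01; rewrite expr0 mulr1.
Qed.

Lemma cnorm_qpoch_le (X : R) x n : cnorm x <= X ->
  cnorm (qpoch q x n) <= expR (X / (1 - q0)).
Proof.
move=> xX; rewrite -hpoch1; have := @cnorm_hpoch_le 1 X 1 x n ltr01.
by rewrite cnorm1 lexx divr1 expr1n mulr1 => /(_ isT xX).
Qed.

(** From some index K on, the sum of |x| q^k is at most 1/2, so the product of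
    the factors beyond K has modulus at least 1 - 1/2.  To treat all n alike,
    (x; q)_n is compared with (x; q)_(n+K), at the cost of the upper bound B on
    the K additional factors. *)
Lemma cnorm_qpoch_ge x : not_qpole q x ->
  exists2 m : R, 0 < m & forall n, m <= cnorm (qpoch q x n).
Proof.
move=> xP; have r1 : 0 < 1 - q0 by rewrite subr_gt0; case/andP: q01.
have [K KP] : exists K, cnorm x / (1 - q0) * q0 ^+ K <= 1 / 2.
  have : geometric (cnorm x / (1 - q0)) q0 @ \oo --> 0.
    by apply: cvg_geometric; rewrite ger0_norm; case/andP: q0_01.
  have h2 : 0 < 1 / 2 :> R by rewrite divr_gt0.
  move=> /cvgrPdist_lt /(_ _ h2) [N _ /(_ N (leqnn _))] /=.
  by rewrite sub0r normrN => h; exists N; apply: le_trans (ler_norm _) (ltW h).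
have low n : 1 / 2 <= cnorm (qpoch q (x * q ^+ K) n).
  pose S n := \sum_(0 <= k < n) cnorm x * q0 ^+ K * q0 ^+ k.
  have S2 j : S j <= 1 / 2.
    apply: le_trans (geometric_tail_le 0 j _ q0_01) _.
      by rewrite mulr_ge0 ?cnorm_ge0 ?exprn_ge0 // (andP q0_01).1.
    by rewrite expr0 mulr1 mulrAC.
  have t0 j : 0 <= cnorm x * q0 ^+ K * q0 ^+ j.
    by rewrite !mulr_ge0 ?cnorm_ge0 ?exprn_ge0 // (andP q0_01).1.
  have SS j : S j.+1 = S j + cnorm x * q0 ^+ K * q0 ^+ j by rewrite /S big_nat_recr.
  have S0 j : 0 <= S j by apply: sumr_ge0.
  have low' : 1 - S n <= cnorm (qpoch q (x * q ^+ K) n).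
    elim: n => [|n IH]; first by rewrite qpoch0 cnorm1 /S big_geq // subr0.
    rewrite qpochS cnormM.
    have h : 1 - cnorm x * q0 ^+ K * q0 ^+ n <= cnorm (1 - x * q ^+ K * q ^+ n).
      have := cnormD (1 - x * q ^+ K * q ^+ n) (x * q ^+ K * q ^+ n).
      by rewrite subrK cnorm1 !cnormM !cnorm_qX lerBlDr.
    have := S2 n.+1; have := S0 n; have := t0 n; rewrite SS => *.
    apply: (@le_trans _ _ ((1 - S n) * (1 - cnorm x * q0 ^+ K * q0 ^+ n))).
      nra.
    apply: ler_pM => //; lra.
  have := S2 n; lra.
pose B := expR (cnorm x / (1 - q0)).
exists (cnorm (qpoch q x K) * (1 / 2) / B).
  by rewrite divr_gt0 ?expR_gt0 // mulr_gt0 ?divr_gt0 // cnorm_gt0 qpoch_neq0.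
move=> n; rewrite ler_pdivrMr ?expR_gt0 //.
apply: (@le_trans _ _ (cnorm (qpoch q x (n + K)))).
  by rewrite addnC qpochD cnormM ler_wpM2l // cnorm_ge0.
rewrite qpochD cnormM ler_wpM2l ?cnorm_ge0 // cnorm_qpoch_le //.
rewrite cnormM cnorm_qX ler_piMr ?cnorm_ge0 // exprn_ile1 //.
  by case/andP: q0_01.
by case/andP: q0_01 => _ /ltW.
Qed.

(** The increments (x; q)_(n+1) - (x; q)_n = - (x; q)_n x q^n are O(q^n). *)
Lemma cvg_qpoch x : (fun n => qpoch q x n) @ \oo --> qpoch_inf q x.
Proof.
pose u n := - (qpoch q x n * (x * q ^+ n)).
have uE n : series u n = qpoch q x n - 1.
  elim: n => [|n IH]; first by rewrite /series /= big_geq // qpoch0 subrr.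
  by rewrite /series /= big_nat_recr //= -[X in X + _]/(series u n) IH qpochS /u; ring.
have [||l ul] := @cvg_series_geometric_bound R u (expR (cnorm x / (1 - q0)) * cnorm x) q0.
- exact: q0_01.
- move=> n; rewrite /u cnormN !cnormM cnorm_qX mulrA ler_wpM2r ?exprn_ge0 ?(andP q0_01).1 //.
  by rewrite ler_wpM2r ?cnorm_ge0 // cnorm_qpoch_le.
have : (fun n => qpoch q x n) @ \oo --> l + 1.
  have -> : (fun n => qpoch q x n) = (fun n => series u n + 1).
    by apply/funext => n; rewrite uE subrK.
  exact: (cvgD ul (cvg_cst (1 : C))).
move=> h; rewrite /qpoch_inf (cvg_lim _ h) //; exact: norm_hausdorff.
Qed.

Lemma qpoch_inf_neq0 x : not_qpole q x -> qpoch_inf q x != 0.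
Proof.
move=> /cnorm_qpoch_ge[m m0 xm]; apply/negP => /eqP x0.
have := cvgC_cnorm (@cvg_qpoch x); rewrite x0 => /cvgrPdist_lt /(_ _ m0).
move=> [N _ /(_ N (leqnn _))] /=.
by rewrite subr0 sub0r normrN ger0_norm ?cnorm_ge0 // ltNge xm.
Qed.

Lemma qpoch_inf_shift x k : qpoch_inf q x = qpoch q x k * qpoch_inf q (x * q ^+ k).
Proof.
have h : (fun n => qpoch q x (k + n)%N) @ \oo --> qpoch_inf q x.
  by have := @cvg_qpoch x; rewrite -(cvg_shiftn k); under eq_fun do rewrite addnC.
apply: cvg_unique h _ => //.
rewrite (_ : (fun _ => _) = fun n => qpoch q x k * qpoch q (x * q ^+ k) n).
  by apply: cvgMr; exact: cvg_qpoch.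
by apply/funext => n; rewrite qpochD.
Qed.
End Bounds.

(** * The very-well-poised sum *)

Section Summation.
Variable R : realType.
Local Notation C := (Num.NumField.sort (R[i] : numFieldType)).
Variable q0 : R.
Hypothesis q01 : 0 < q0 < 1.
Let q : C := q0%:C.
Implicit Types x y z a b alpha : C.

Lemma dominated_qpoch x : dominated (fun n => qpoch q x n) (fun=> 1).
Proof.
by exists (expR (cnorm x / (1 - q0))) => n; rewrite mulr1 cnorm_qpoch_le.
Qed.

Lemma dominated_qpochV x : not_qpole q x ->
  dominated (fun n => (qpoch q x n)^-1) (fun=> 1).
Proof.
move=> /(cnorm_qpoch_ge q01)[m m0 xm]; exists m^-1 => n.
by rewrite mulr1 cnormV lef_pV2 ?posrE // (lt_le_trans m0).
Qed.

Lemma dominated_qpoch_shift (A : R) x : 0 < A -> cnorm x <= A ->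
  dominated (fun n => qpoch_shift q x n) (fun n => A ^+ n).
Proof.
move=> A0 xA; exists (expR (cnorm q / A / (1 - q0))) => n.
by rewrite qpoch_shift_hpoch cnorm_hpoch_le.
Qed.

Lemma dominated_exp x : dominated (fun n => x ^+ n) (fun n => cnorm x ^+ n).
Proof. by exists 1 => n; rewrite mul1r cnormX. Qed.

Lemma cnorm_qX_le1 n : cnorm (q ^+ n) <= 1.
Proof.
rewrite cnorm_qX // exprn_ile1 //; first by case/andP: (q0_01 q01).
by case/andP: (q0_01 q01) => _ /ltW.
Qed.

Lemma dominated_vwp_factor x :
  dominated (fun p : nat * nat => vwp_factor q (x * q ^+ p.1) p.2) (fun=> 1).
Proof.
pose B := expR (cnorm x / (1 - q0)).
have B1 : 1 <= B.
  by rewrite -expR0 ler_expR divr_ge0 ?cnorm_ge0 // subr_ge0; case/andP: q01 => _ /ltW.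
have le_x y n : cnorm y <= cnorm x -> cnorm (y * q ^+ n) <= cnorm x.
  move=> yx; apply: le_trans yx; rewrite cnormM ler_piMr ?cnorm_ge0 //.
  exact: cnorm_qX_le1.
exists ((1 + cnorm x) * B) => -[N [|m]] /=; rewrite mulr1.
  by rewrite cnorm1 mulr_ege1 // lerDl cnorm_ge0.
rewrite cnormM; apply: ler_pM; rewrite ?cnorm_ge0 //.
  apply: le_trans (cnormD _ _) _; rewrite cnorm1 cnormN lerD2l.
  by apply: (le_x); apply: le_x.
by apply: cnorm_qpoch_le => //; rewrite -[q in _ * q]expr1; apply: (le_x); apply: le_x.
Qed.

(** Uniform in the shift, because (x q^N; q)_m = (x; q)_(N+m) / (x; q)_N. *)
Lemma dominated_qpochV_shift x : not_qpole q x ->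
  dominated (fun p : nat * nat => (qpoch q (x * q ^+ p.1) p.2)^-1) (fun=> 1).
Proof.
move=> xP.
have -> : (fun p : nat * nat => (qpoch q (x * q ^+ p.1) p.2)^-1)
  = ((fun n => qpoch q x n) \o fst) \*
    ((fun n => (qpoch q x n)^-1) \o (fun p => p.1 + p.2)%N).
  apply/funext => -[N m] /=; rewrite qpochD invfM mulrA divff ?mul1r //.
  exact: qpoch_neq0.
have := dominatedM (dominated_comp fst (dominated_qpoch x))
  (dominated_comp (fun p : nat * nat => (p.1 + p.2)%N) (dominated_qpochV xP)).
by case=> M h; exists M => p; have := h p; rewrite /= !mulr1.
Qed.

Lemma cvg_dominated (u : nat -> C) (r : R) :
  0 <= r < 1 -> dominated u (fun n => r ^+ n) -> u @ \oo --> (0 : C).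
Proof.
move=> r01 [M uM]; apply: (@cvgC_dominated _ _ _ (fun n => M * r ^+ n)).
  by move=> n; rewrite subr0.
by apply: (cvg_geometric M); rewrite ger0_norm; case/andP: r01.
Qed.

(** Strictly positive majorants exist even when a = 0 or b = 0: enlarge |a| and
    |b| by a small e, which adds at most e |alpha| (|a| + |b| + 1) to
    |alpha a b|. *)
Lemma majorants alpha a b : `|alpha * a * b / q| < 1 ->
  exists A B : R, [/\ 0 < A, 0 < B, cnorm a <= A, cnorm b <= B
    & cnorm alpha * A * B / q0 < 1].
Proof.
have q00 := q0_gt0 q01.
rewrite cnormE -[1]/(1%:C) ltcR !cnormM cnormV cnorm_real ?(ltW q00) //.
rewrite ltr_pdivrMr // mul1r.
have := cnorm_ge0 a; have := cnorm_ge0 b; have := cnorm_ge0 alpha.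
move: (cnorm alpha) (cnorm a) (cnorm b) => t x y t0 y0 x0 h.
pose w := t * (x + y + 1).
have w0 : 0 <= w by rewrite mulr_ge0 // !addr_ge0.
have d0 : 0 < q0 - t * x * y by rewrite subr_gt0.
have v0 : 0 < w + 1 by rewrite ltr_wpDl.
pose e := Num.min 1 ((q0 - t * x * y) / (w + 1)).
have e0 : 0 < e by rewrite lt_min ltr01 divr_gt0.
have e1 : e <= 1 by rewrite ge_min lexx.
have es : e * (w + 1) <= q0 - t * x * y.
  by rewrite -ler_pdivlMr // ge_min lexx orbT.
exists (x + e), (y + e); split.
- by rewrite ltr_wpDl.
- by rewrite ltr_wpDl.
- by rewrite lerDl ltW.
- by rewrite lerDl ltW.
rewrite ltr_pdivrMr // mul1r.
have le1 : t * (x + e) * (y + e) <= t * x * y + e * w.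
  have -> : t * (x + e) * (y + e) = t * x * y + e * (t * (x + y + e)) by ring.
  by rewrite lerD2l ler_wpM2l ?(ltW e0) // ler_wpM2l // lerD2l.
apply: le_lt_trans le1 _; rewrite -ltrBrDl; apply: lt_le_trans es.
by rewrite ltr_pM2l // ltrDl.
Qed.

Lemma not_qpole_q : not_qpole q q.
Proof.
move=> k; apply/negP => /eqP e; have := qpoch_qq_neq0 q01 k.+1; rewrite -/q.
have qk : q ^+ k != 0 by rewrite expf_neq0 // q_neq0.
by rewrite qpochS [X in 1 - X * _]e mulVf // subrr mulr0 eqxx.
Qed.

(** The bound is uniform in N, with ratio q^N r: this yields both convergence
    for every N and the limit 1 of the sums as N grows. *)
Lemma cnorm_vwp_term_le alpha a b :
  `|alpha * a * b / q| < 1 ->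
  not_qpole q (alpha * a) -> not_qpole q (alpha * b) ->
  exists M r : R, 0 <= r < 1 /\ forall N m,
      cnorm (vwp_term q (alpha * q ^+ N) a b m) <= M * (q0 ^+ N * r) ^+ m.
Proof.
move=> /majorants[A [B [A0 B0 aA bB ABr]]] aP bP.
have q00 := q0_gt0 q01.
have dC : dominated (fun m => q ^+ 'C(m, 2)) (fun=> 1).
  by exists 1 => m; rewrite mulr1 cnorm_qX_le1.
have dP : dominated (fun p : nat * nat => (- (alpha * q ^+ p.1 / q)) ^+ p.2)
    (fun p => (cnorm alpha * q0 ^+ p.1 / q0) ^+ p.2).
  exists 1 => p; rewrite mul1r cnormX cnormN !cnormM cnormV cnorm_qX //.
  by rewrite cnorm_real // ltW.
have sndc := dominated_comp (@snd nat nat).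
have [M H] := dominatedM (dominatedM (dominatedM (dominatedM (dominatedM
   (dominatedM (dominatedM (dominated_vwp_factor alpha)
   (sndc _ _ _ (dominated_qpoch_shift A0 aA)))
   (sndc _ _ _ (dominated_qpoch_shift B0 bB))) dP) (sndc _ _ _ dC))
   (sndc _ _ _ (dominated_qpochV not_qpole_q)))
   (dominated_qpochV_shift aP)) (dominated_qpochV_shift bP).
exists M, (cnorm alpha * A * B / q0); split.
  by rewrite ABr andbT !mulr_ge0 ?invr_ge0 ?cnorm_ge0 ?(ltW A0) ?(ltW B0) ?(ltW q00).
move=> N m; have := H (N, m); rewrite /= !mulr1 !mul1r -!exprMn.
have -> : A * B * (cnorm alpha * q0 ^+ N / q0) = q0 ^+ N * (cnorm alpha * A * B / q0) by ring.
rewrite /vwp_term ![alpha * q ^+ N * _]mulrAC !invfM !mulrA.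
exact.
Qed.

Lemma cvg_vwp_boundary alpha a b :
  `|alpha * a * b / q| < 1 ->
  not_qpole q (alpha * a) -> not_qpole q (alpha * b) ->
  (fun n => - ((1 - alpha * a) * (1 - alpha * b) * qpoch q (alpha * q) n
      * qpoch_shift q a n.+1 * qpoch_shift q b n.+1
      * (- (alpha / q)) ^+ n.+1 * q ^+ 'C(n.+1, 2)
      / (qpoch q q n * qpoch q (alpha * a) n.+1 * qpoch q (alpha * b) n.+1)))
  @ \oo --> (0 : C).
Proof.
move=> /majorants[A [B [A0 B0 aA bB ABr]]] aP bP.
have q00 := q0_gt0 q01.
pose r := cnorm alpha * A * B / q0.
have r0 : 0 <= r.
  by rewrite !mulr_ge0 ?invr_ge0 ?cnorm_ge0 ?(ltW A0) ?(ltW B0) ?(ltW q00).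
have dC : dominated (fun m => q ^+ 'C(m, 2)) (fun=> 1).
  by exists 1 => m; rewrite mulr1 cnorm_qX_le1.
have Sc := dominated_comp S.
have [M H] := dominatedM (dominatedM (dominatedM (dominatedM (dominatedM
   (dominatedM (dominatedM (dominated_qpoch (alpha * q))
   (Sc _ _ _ (dominated_qpoch_shift A0 aA)))
   (Sc _ _ _ (dominated_qpoch_shift B0 bB)))
   (Sc _ _ _ (dominated_exp (- (alpha / q))))) (Sc _ _ _ dC))
   (dominated_qpochV not_qpole_q))
   (Sc _ _ _ (dominated_qpochV aP))) (Sc _ _ _ (dominated_qpochV bP)).
apply: (@cvg_dominated _ r); first by rewrite r0.
pose K := cnorm ((1 - alpha * a) * (1 - alpha * b)).
exists (K * M * r) => n; have := H n; rewrite /= !mulr1 !mul1r -!exprMn.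
have -> : A * B * cnorm (- (alpha / q)) = r.
  by rewrite cnormN cnormM cnormV cnorm_real ?(ltW q00) // /r; ring.
rewrite [r ^+ n.+1]exprS (mulrA M); clearbody r => h; rewrite cnormN; set c := (1 - alpha * a) * _.
rewrite -!(mulrA c) cnormM -!(mulrA K) ler_wpM2l ?cnorm_ge0 //.
by move: h; rewrite !invfM !mulrA.
Qed.

(** The limit of [vwp_term_telescope], whose boundary term vanishes. *)
Lemma vwp_sum_contiguous alpha a b (l l' : C) :
  `|alpha * a * b / q| < 1 ->
  not_qpole q (alpha * a) -> not_qpole q (alpha * b) ->
  series (vwp_term q alpha a b) @ \oo --> l ->
  series (vwp_term q (alpha * q) a b) @ \oo --> l' ->
  (1 - alpha * a) * (1 - alpha * b) * l
    = (1 - alpha * q) * (1 - alpha * a * b / q) * l'.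
Proof.
move=> h aP bP hl hl'; apply/eqP; rewrite -subr_eq0; apply/eqP.
set p := (1 - alpha * a) * _ in hl *; set p' := (1 - alpha * q) * _ in hl' *.
have c1 : (fun n => p * series (vwp_term q alpha a b) n
    - p' * series (vwp_term q (alpha * q) a b) n) @ \oo --> p * l - p' * l'.
  exact: (cvgB (cvgM (cvg_cst p) hl) (cvgM (cvg_cst p') hl')).
have c0 := cvg_vwp_boundary h aP bP.
apply: (cvgC_unique (cvgC_shiftS c1)).
apply: cvgC_ext c0 => n.
rewrite /series /= !big_mkord.
have qr := qpoch_qq_neq0 q01.
by rewrite -(vwp_term_telescope (q_neq0 q01) qr) // => m; exact: qpoch_neq0.
Qed.

(** Iterating [vwp_sum_contiguous] N times relates the sum at alpha to the sum
    at alpha q^N, which tends to its term of index 0, that is to 1.  The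
    relation is kept free of denominators until the limit. *)
Lemma vwp_sum alpha a b :
  `|alpha * a * b / q| < 1 ->
  not_qpole q (alpha * a) -> not_qpole q (alpha * b) ->
  series (vwp_term q alpha a b) @ \oo -->
    qpoch_inf q (alpha * q) * qpoch_inf q (alpha * a * b / q)
    / (qpoch_inf q (alpha * a) * qpoch_inf q (alpha * b)).
Proof.
move=> h aP bP; have [M [r [r01 H]]] := cnorm_vwp_term_le h aP bP.
have q00 := q0_gt0 q01; have [r0 r1] := andP r01.
have qN N : 0 <= q0 ^+ N <= 1.
  by rewrite exprn_ge0 ?(ltW q00) // exprn_ile1 ?(ltW q00) //; case/andP: q01 => _ /ltW.
have rN N : 0 <= q0 ^+ N * r < 1.
  have /andP[? ?] := qN N.
  by rewrite mulr_ge0 //= (le_lt_trans _ r1) // ler_piMl.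
pose l N := lim (series (vwp_term q (alpha * q ^+ N) a b) @ \oo).
have cl N : series (vwp_term q (alpha * q ^+ N) a b) @ \oo --> l N.
  by have [x hx] := cvg_series_geometric_bound (rN N) (H N); apply/cvg_ex; exists x.
have shift x N : alpha * q ^+ N * x = alpha * x * q ^+ N by rewrite mulrAC.
(* l N is the sum at alpha q^N. *)
have lE N : qpoch q (alpha * a) N * qpoch q (alpha * b) N * l 0%N
    = qpoch q (alpha * q) N * qpoch q (alpha * a * b / q) N * l N.
  elim: N => [|N IH]; first by rewrite !qpoch0.
  have -> : qpoch q (alpha * a) N.+1 * qpoch q (alpha * b) N.+1 * l 0%N
    = (qpoch q (alpha * a) N * qpoch q (alpha * b) N * l 0%N)
      * ((1 - alpha * a * q ^+ N) * (1 - alpha * b * q ^+ N)).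
    by rewrite !qpochS; ring.
  rewrite IH; have hN : `|alpha * q ^+ N * a * b / q| < 1.
    have -> : alpha * q ^+ N * a * b / q = (alpha * a * b / q) * q ^+ N by ring.
    move: (h); rewrite !cnormE [cnorm (_ * q ^+ N)]cnormM -[1]/(1%:C) !ltcR; apply: le_lt_trans.
    by rewrite ler_piMr ?cnorm_ge0 ?cnorm_qX_le1.
  have aN : not_qpole q (alpha * q ^+ N * a).
    by rewrite (shift a N); exact: (not_qpoleM (q_neq0 q01)).
  have bN : not_qpole q (alpha * q ^+ N * b).
    by rewrite (shift b N); exact: (not_qpoleM (q_neq0 q01)).
  have cl1 : series (vwp_term q (alpha * q ^+ N * q) a b) @ \oo --> l N.+1.
    by have := cl N.+1; rewrite exprSr mulrA.
  have := vwp_sum_contiguous hN aN bN (cl N) cl1.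
  rewrite (shift a N) (shift b N) => e.
  rewrite (_ : alpha * a * q ^+ N * b / q = alpha * a * b / q * q ^+ N) in e; last by ring.
  rewrite !qpochS.
  transitivity (qpoch q (alpha * q) N * qpoch q (alpha * a * b / q) N *
    ((1 - alpha * a * q ^+ N) * (1 - alpha * b * q ^+ N) * l N)); first by ring.
  by rewrite e; ring.
have l1 : l @ \oo --> (1 : C).
  apply: (@cvgC_dominated _ _ _ (fun N => M * r / (1 - r) * q0 ^+ N)).
    move=> N; have /andP[qN0 qN1] := qN N; have /andP[rN0 rN1] := rN N.
    have := series_tail_le 1 (rN N) (H N) (cl N).
    rewrite /series /= big_nat1 /vwp_term !qpoch_shift_hpoch !hpoch0 !qpoch0.
    rewrite bin0n !expr0 !mulr1 invr1 /= mulr1 => e; apply: le_trans e _.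
    have M0 : 0 <= M.
      by have := le_trans (cnorm_ge0 _) (H 0%N 0%N); rewrite [(_ * r) ^+ 0]expr0 mulr1.
    rewrite expr1 (_ : M * r / (1 - r) * q0 ^+ N = M * (q0 ^+ N * r) / (1 - r)); last by ring.
    rewrite ler_wpM2l ?mulr_ge0 // lef_pV2 ?posrE ?subr_gt0 // lerB //.
    by rewrite ler_piMl.
  rewrite -[X in _ --> X](mulr0 (M * r / (1 - r))); apply: cvgMr.
  by apply: cvg_expr; rewrite ger0_norm ?(ltW q00) //; case/andP: q01.
have nz : qpoch_inf q (alpha * a) * qpoch_inf q (alpha * b) != 0.
  by rewrite mulf_neq0 //; apply: qpoch_inf_neq0.
suff <- : l 0%N = qpoch_inf q (alpha * q) * qpoch_inf q (alpha * a * b / q)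
    / (qpoch_inf q (alpha * a) * qpoch_inf q (alpha * b)).
  by have := cl 0%N; rewrite expr0 mulr1.
apply: (mulIf nz); rewrite divfK // mulrC.
have c x := @cvg_qpoch _ _ q01 x.
have cL : (fun n => qpoch q (alpha * a) n * qpoch q (alpha * b) n * l 0%N) @ \oo
    --> qpoch_inf q (alpha * a) * qpoch_inf q (alpha * b) * l 0%N.
  exact: (cvgM (cvgM (c _) (c _)) (cvg_cst (l 0%N))).
have cR : (fun n => qpoch q (alpha * q) n * qpoch q (alpha * a * b / q) n * l n)
    @ \oo --> qpoch_inf q (alpha * q) * qpoch_inf q (alpha * a * b / q) * 1.
  exact: (cvgM (cvgM (c _) (c _)) l1).
rewrite -[RHS]mulr1; apply: (cvgC_unique cL); apply: cvgC_ext cR => n.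
by rewrite lE.
Qed.

End Summation.

(** * The expansion *)

Section Expansion.
Variable R : realType.
Local Notation C := (Num.NumField.sort (R[i] : numFieldType)).
Variable q0 : R.
Hypothesis q01 : 0 < q0 < 1.
Let q : C := q0%:C.
Variables alpha a b c d beta : C.
Hypothesis small : `|alpha * a * b / q| < 1.
Hypotheses (aP : not_qpole q (alpha * a)) (bP : not_qpole q (alpha * b)).
Hypotheses (cP : not_qpole q c) (dP : not_qpole q d).

Let f k m := vwp_term q alpha a b (k + m)
  * phi32_term q (q ^- (k + m)) (alpha * q ^+ (k + m)) beta c d q k.

(** The factors of length k + m contribute A^(k+m) B^(k+m) |alpha/q|^(k+m), and
    all others are bounded. *)
Lemma cnorm_terms_le : exists M r : R, [/\ 0 <= r < 1,
  forall k, cnorm (phi32_shift_term q a b beta c d alpha k) <= M * r ^+ k &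
  forall k m, cnorm (f k m) <= M * r ^+ (k + m)].
Proof.
have [A [B [A0 B0 aA bB ABr]]] := majorants q01 small.
have q00 := q0_gt0 q01.
pose r := cnorm alpha * A * B / q0.
have r01 : 0 <= r < 1.
  by rewrite ABr andbT !mulr_ge0 ?invr_ge0 ?cnorm_ge0 ?(ltW A0) ?(ltW B0) ?(ltW q00).
have ABE : A * B * cnorm (alpha / q) = r.
  by rewrite cnormM cnormV cnorm_real ?(ltW q00) // /r; ring.
clearbody r.
have dV x : not_qpole q x -> dominated (fun n => (qpoch q x n)^-1) (fun=> 1).
  exact: dominated_qpochV.
have dq := dV _ (not_qpole_q q01).
have dB := dominated_qpoch q01 beta.
have dS := dominatedM (dominatedM (dominated_qpoch_shift q01 A0 aA)
  (dominated_qpoch_shift q01 B0 bB)) (dominated_exp (alpha / q)).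
have dK := dominatedM (dominatedM (dominatedM dB dq) (dV _ cP)) (dV _ dP).
have [M1 H1] := dominatedM dK dS.
have dC : dominated (fun m => (-1) ^+ m * q ^+ 'C(m, 2)) (fun=> 1).
  exists 1 => m; rewrite mulr1 cnormM [cnorm ((-1) ^+ m)]cnormX cnormN cnorm1 expr1n mul1r.
  exact: cnorm_qX_le1.
have dW : dominated (fun p : nat * nat => vwp_factor q (alpha * q ^+ (2 * p.1)) p.2)
    (fun=> 1).
  exact: (dominated_comp (fun p : nat * nat => (2 * p.1, p.2)%N)
    (dominated_vwp_factor q01 alpha)).
have dQ : dominated (fun p : nat * nat => qpoch q (alpha * q) (2 * p.1)) (fun=> 1).
  exact: (dominated_comp (fun p : nat * nat => (2 * p.1)%N) (dominated_qpoch q01 _)).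
pose s (p : nat * nat) := (p.1 + p.2)%N.
have [M2 H2] := dominatedM (dominatedM (dominatedM (dominated_comp fst dK)
  (dominatedM dQ dW)) (dominated_comp s dS))
  (dominatedM (dominatedM (dominatedM (dominated_comp snd dC)
    (dominated_comp snd dq)) (dominated_comp s (dV _ aP)))
    (dominated_comp s (dV _ bP))).
have [r0 _] := andP r01.
exists (Num.max M1 M2), r; split=> //.
- move=> k; apply: (@le_trans _ _ (M1 * r ^+ k)); last first.
    by rewrite ler_wpM2r ?exprn_ge0 // le_max lexx.
  have := H1 k; rewrite /= !mulr1 !mul1r -!exprMn ABE.
  rewrite /phi32_shift_term /qpochs !big_cons big_nil mulr1.
  apply: le_trans; rewrite le_eqVlt; apply/orP; left; apply/eqP; congr cnorm.
  by rewrite !invfM; ring.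
- move=> k m; apply: (@le_trans _ _ (M2 * r ^+ (k + m))); last first.
    by rewrite ler_wpM2r ?exprn_ge0 // le_max lexx orbT.
  have := H2 (k, m); rewrite /= !mulr1 !mul1r -!exprMn ABE /f.
  rewrite vwp_term_phi32_term //; try by move=> n; exact: qpoch_neq0.
  + apply: le_trans; rewrite le_eqVlt; apply/orP; left; apply/eqP; congr cnorm.
    by rewrite /s !invfM; ring.
  + exact: q_neq0.
  + exact: qpoch_qq_neq0.
Qed.

Let P := qpoch_inf q (alpha * q) * qpoch_inf q (alpha * a * b / q)
  / (qpoch_inf q (alpha * a) * qpoch_inf q (alpha * b)).

(** [vwp_sum] at (alpha q^(2k), a q^-k, b q^-k): the infinite products there
    are tails of those in P, and the finite prefactors complete them. *)
Lemma cvg_row k :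
  series (f k) @ \oo --> P * phi32_shift_term q a b beta c d alpha k.
Proof.
have qn : q != 0 := q_neq0 q01; have qk : q ^+ k != 0 by rewrite expf_neq0.
have E x : alpha * q ^+ (2 * k) * (x / q ^+ k) = alpha * x * q ^+ k.
  by rewrite mulnC exprM; field.
have E1 : alpha * q ^+ (2 * k) * (a / q ^+ k) * (b / q ^+ k) / q = alpha * a * b / q.
  by rewrite E; field; rewrite ?qk ?qn.
have row m : f k m = phi32_shift_term q a b beta c d alpha k
    * (qpoch q (alpha * q) (2 * k) / (qpoch q (alpha * a) k * qpoch q (alpha * b) k))
    * vwp_term q (alpha * q ^+ (2 * k)) (a / q ^+ k) (b / q ^+ k) m.
  apply: vwp_term_phi32_row => //; try by move=> n; exact: qpoch_neq0.
  exact: qpoch_qq_neq0.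
have := @vwp_sum R q0 q01 (alpha * q ^+ (2 * k)) (a / q ^+ k) (b / q ^+ k).
rewrite -/q E1 !E => /(_ small (not_qpoleM qn k aP) (not_qpoleM qn k bP)) hS.
set p := phi32_shift_term q a b beta c d alpha k * _ in row.
have -> : P * phi32_shift_term q a b beta c d alpha k
  = p * (qpoch_inf q (alpha * q ^+ (2 * k) * q) * qpoch_inf q (alpha * a * b / q)
    / (qpoch_inf q (alpha * a * q ^+ k) * qpoch_inf q (alpha * b * q ^+ k))).
  rewrite /P (qpoch_inf_shift q01 (alpha * q) (2 * k)).
  rewrite (qpoch_inf_shift q01 (alpha * a) k) (qpoch_inf_shift q01 (alpha * b) k).
  rewrite -/q (mulrAC alpha q) /p.
  move: (phi32_shift_term _ _ _ _ _ _ _ k) (qpoch q _ (2 * k)).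
  move: (qpoch q (alpha * a) k) (qpoch q (alpha * b) k).
  move: (qpoch_inf q (alpha * a * b / q)) (qpoch_inf q (alpha * a * _)).
  move: (qpoch_inf q (alpha * b * _)) (qpoch_inf q _) => *.
  by rewrite !invfM; ring.
apply: cvgC_ext (cvgM (cvg_cst p) hS) => n.
by rewrite /series /= mulr_sumr; apply: eq_bigr => m _; rewrite row.
Qed.

Lemma cvg_phi32_shift : cvg (series (phi32_shift_term q a b beta c d alpha) @ \oo).
Proof.
have [M [r [r01 H _]]] := cnorm_terms_le.
by have [l hl] := cvg_series_geometric_bound r01 H; apply/cvg_ex; exists l.
Qed.

(** Summing the rows first gives the right-hand side; [cvg_series_triangle]
    says that the diagonals give the same value. *)
Lemma cvg_expansion :
  series (fun n => \sum_(k < n.+1) vwp_term q alpha a b n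
      * phi32_term q (q ^- n) (alpha * q ^+ n) beta c d q k) @ \oo
    --> P * phi32_shift q a b beta c d alpha.
Proof.
have [M [r [r01 _ H]]] := cnorm_terms_le.
have FL : series (fun k => P * phi32_shift_term q a b beta c d alpha k) @ \oo
    --> P * phi32_shift q a b beta c d alpha.
  apply: cvgC_ext (cvgM (cvg_cst P) cvg_phi32_shift) => n.
  by rewrite /series /= mulr_sumr.
apply: cvgC_ext (cvg_series_triangle r01 H cvg_row FL) => n.
apply: eq_bigr => m _; apply: eq_bigr => -[k /= km] _.
by rewrite /f subnKC.
Qed.
End Expansion.

Theorem theorem1p12 (R : realType) (q0 : R) (alpha a b c d beta : R[i]) :
  let q : R[i] := q0%:C in
  0 < q0 < 1 ->
  `|alpha * a * b / q| < 1 ->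
  beta != 0 -> c != 0 ->
  not_qpole q (alpha * a) -> not_qpole q (alpha * b) ->
  not_qpole q c -> not_qpole q d -> not_qpole q (q * alpha / c) ->
  cvg (series (phi32_shift_term q a b beta c d alpha) @ \oo) /\
  series (fun n : nat =>
      vwp_factor q alpha n * qpoch_shift q a n * qpoch_shift q b n
        * qpoch q (q * alpha / c) n
        * (alpha * c) ^+ n * q ^ (n%:Z ^+ 2 - 2 * n%:Z)
      / qpochs q [:: q; alpha * a; alpha * b; c] n
      * phi32 q (q ^- n) (alpha * q ^+ n) (d / beta) d (q * alpha / c)
          (q * beta / c)) @ \oo
    --> qpochs_inf q [:: alpha * q; alpha * a * b / q]
        / qpochs_inf q [:: alpha * a; alpha * b]
        * phi32_shift q a b beta c d alpha.
Proof.
move=> q q01 small b0 c0 aP bP cP dP eP; split.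
  exact: cvg_phi32_shift.
rewrite /qpochs_inf !big_cons !big_nil !mulr1.
have h := @cvg_expansion R q0 q01 alpha a b c d beta small aP bP cP dP.
set F := (X in series X); have -> : F = (fun n => \sum_(k < n.+1) vwp_term q alpha a b n
    * phi32_term q (q ^- n) (alpha * q ^+ n) beta c d q k).
  apply/funext => n; rewrite /F expansion_termE //; try by move=> k; exact: qpoch_neq0.
  - exact: q_neq0.
  - exact: qpoch_qq_neq0.
exact: h.
Qed.
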